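(* Let $k\ge17$ be an integer and let $T$ be a tree with $k$ leaves. Then there exist two finite families $F_1,F_2$ of subtrees of $T$ with the following property: whenever $H_1\subseteq F_1$ and $H_2\subseteq F_2$ are such that either every member of $H_1$ intersects every member of $H_2$, or every member of $H_1$ is disjoint from every member of $H_2$, then $|H_i|\le \frac{2\ln k}{k\ln 2}\,|F_i|$ for some $i\in\{1,2\}$.
   Context: A subtree of a tree $T$ is a connected subgraph of $T$; two subtrees intersect if they share a vertex. Families may contain repeated members (multisets), and sizes count multiplicity. *)

(* Defs.v *)
From mathcomp Require Import all_boot all_order all_algebra.
From mathcomp Require Import finmap multiset.
From mathcomp Require Import reals exp.

Set Implicit Arguments.
Unset Strict Implicit.
Unset Printing Implicit Defensive.

Import Order.TTheory GRing.Theory Num.Theory.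

(** Finite simple graphs, given by their adjacency relation [e] on a finite
    vertex type [V]. *)

Definition simple_graph (V : finType) (e : rel V) : Prop :=
  symmetric e /\ irreflexive e.

Definition connected_graph (V : finType) (e : rel V) : Prop :=
  (0 < #|V|)%N /\ forall x y : V, connect e x y.

(* [ucycle e c] also holds for [:: x; y] when x and y are adjacent, hence the
   size condition. *)
Definition acyclic_graph (V : finType) (e : rel V) : Prop :=
  forall c : seq V, ucycle e c -> (size c <= 2)%N.

Definition is_tree (V : finType) (e : rel V) : Prop :=
  [/\ simple_graph e, connected_graph e & acyclic_graph e].

Definition leaves (V : finType) (e : rel V) : {set V} :=
  [set x | #|[set y | e x y]| == 1%N].

(** A subgraph is a pair (vertex set, edge set); an edge is stored as both of
    its orientations. *)

Definition subgraph (V : finType) := ({set V} * {set V * V})%type.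

Definition verts (V : finType) (s : subgraph V) : {set V} := s.1.

Definition edge (V : finType) (s : subgraph V) : rel V :=
  fun x y => (x, y) \in s.2.

Definition is_subgraph (V : finType) (e : rel V) (s : subgraph V) : Prop :=
  forall x y : V, edge s x y ->
    [/\ x \in verts s, y \in verts s, e x y & edge s y x].

Definition connected_subgraph (V : finType) (s : subgraph V) : Prop :=
  verts s != set0 /\
  forall x y : V, x \in verts s -> y \in verts s -> connect (edge s) x y.

Definition is_subtree (V : finType) (e : rel V) (s : subgraph V) : Prop :=
  is_subgraph e s /\ connected_subgraph s.

Definition intersects (V : finType) (s t : subgraph V) : bool :=
  verts s :&: verts t != set0.

(** The number of members of a multiset [F] counted with multiplicity is
    [size F]; [#|F|] would count distinct members only. *)

Definition subtree_family (V : finType) (e : rel V)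
    (F : {mset subgraph V}%mset) : Prop :=
  forall s : subgraph V, s \in F -> is_subtree e s.

Definition all_intersect (V : finType) (H1 H2 : {mset subgraph V}%mset) : Prop :=
  forall s t : subgraph V, s \in H1 -> t \in H2 -> intersects s t.

Definition all_disjoint (V : finType) (H1 H2 : {mset subgraph V}%mset) : Prop :=
  forall s t : subgraph V, s \in H1 -> t \in H2 -> ~~ intersects s t.

(* Main.v *)
(** Let [F1] consist of the [k] leaves and [F2] of the [2 ^ k] subtrees obtained
    by deleting a set of leaves from [T] ([T] stays connected because the inner
    vertices of a simple path are not leaves). If each member of [H2] contains
    all the leaves in [H1], or each avoids them all, then the members of [H2]
    are determined by their traces on the [k - #|H1|] other leaves, so
    [#|H2| <= 2 ^ (k - #|H1|)]; this is at most [2 ^ k / k] as soon as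
    [#|H1| >= log2 k]. *)

Require Import Defs.
From mathcomp Require Import all_boot all_order all_algebra.
From mathcomp Require Import finmap multiset.
From mathcomp Require Import reals exp.

Set Implicit Arguments.
Unset Strict Implicit.
Unset Printing Implicit Defensive.

Import Order.TTheory GRing.Theory Num.Theory.

(** * Counting in multisets and in set families *)

Lemma size_msubset_seq_mset (K : choiceType) (H : {mset K}%mset) (s : seq K) :
  (H `<=` seq_mset s)%mset -> (size H <= count (mem H) s)%N.
Proof.
move=> Hs.
have -> : count (mem H) s = size [seq x <- seq_mset s | x \in H].
  by rewrite size_filter; apply/esym/permP; exact: perm_eq_seq_mset.
have [t /permP pt] : exists t, perm_eq (seq_mset s) (H ++ t).
  exists (seq_mset s `\` H)%mset; apply/allP => a _ /=.
  by rewrite count_cat !count_mem_mset msetE2 subnKC //; exact: (msubsetP Hs).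
have /eqP <- : count (mem H) H == size H by rewrite -all_count; apply/allP.
by rewrite size_filter pt count_cat leq_addr.
Qed.

(** Replaces multiset sizes by numbers of indices, so that [f] need not be injective. *)
Lemma size_msubset_image (T : finType) (K : choiceType) (f : T -> K)
    (A : {set T}) (H : {mset K}%mset) :
  (H `<=` seq_mset [seq f x | x <- enum A])%mset ->
  (size H <= #|[set x in A | f x \in H]|)%N.
Proof.
move=> HA; apply: leq_trans (size_msubset_seq_mset HA) _.
rewrite count_map -size_filter cardE.
apply: uniq_leq_size => [|x]; first by rewrite filter_uniq ?enum_uniq.
by rewrite mem_filter !mem_enum in_set andbC.
Qed.

Lemma card_subsets_of_family (T : finType) (L L1 : {set T})
    (Q : {set {set T}}) :
  L1 \subset L -> {in Q, forall S : {set T}, S \subset L} ->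
  {in Q, forall S : {set T}, L1 \subset S} \/
  {in Q, forall S : {set T}, [disjoint L1 & S]} ->
  (#|Q| * 2 ^ #|L1| <= 2 ^ #|L|)%N.
Proof.
move=> L1L QL QL1.
suff leQ : (#|Q| <= #|powerset (L :\: L1)|)%N.
  apply: leq_trans (leq_mul leQ (leqnn _)) _.
  rewrite card_powerset cardsD (setIidPr L1L) -expnD subnK //.
  exact: subset_leq_card.
case: QL1 => QL1.
(* Every [S] here is the union of [L1] and [S :\: L1], so deleting [L1] loses no information. *)
- have -> : #|Q| = #|[set S :\: L1 | S in Q]|.
    rewrite card_in_imset // => S S' SQ S'Q eqS.
    by rewrite -(setID S L1) -(setID S' L1) eqS !(setIidPr _) ?QL1.
  apply: subset_leq_card; apply/subsetP => _ /imsetP[S SQ ->].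
  by rewrite powersetE setSD ?QL.
- apply: subset_leq_card; apply/subsetP => S SQ.
  by rewrite powersetE subsetD QL // disjoint_sym QL1.
Qed.

(** * Leaf-deleted subtrees *)

Section Trees.
Variables (V : finType) (e : rel V).

Definition induced_subgraph (A : {set V}) : subgraph V :=
  (A, [set p | [&& p.1 \in A, p.2 \in A & e p.1 p.2]]).

Lemma induced_subgraph_is_subgraph (A : {set V}) :
  symmetric e -> is_subgraph e (induced_subgraph A).
Proof.
move=> esym x y; rewrite /edge !inE /= => /and3P[xA yA exy].
by split=> //; rewrite /edge /= yA xA esym.
Qed.

Lemma is_subtree_vertex (x : V) :
  symmetric e -> is_subtree e (induced_subgraph [set x]).
Proof.
move=> esym; split; first exact: induced_subgraph_is_subgraph.
split; first by apply/set0Pn; exists x; rewrite set11.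
by move=> y z /set1P-> /set1P->; exact: connect0.
Qed.

Lemma inner_notin_leaves (x y z : V) :
  e y x -> e y z -> x != z -> y \notin leaves e.
Proof.
move=> eyx eyz xz; rewrite inE; apply/eqP => y1.
have /subset_leq_card : [set x; z] \subset [set w | e y w].
  by apply/subsetP => w /set2P[]->; rewrite inE.
by rewrite cards2 xz y1.
Qed.

Lemma uniq_path_of_connect (x y : V) : connect e x y ->
  exists p, [/\ path e x p, uniq (x :: p) & last x p = y].
Proof.
move=> /connectP[p ep ->]; case/shortenP: ep => q eq uq _.
by exists q.
Qed.

(** If all vertices were leaves, no simple path could have an inner vertex, so every vertex other
    than a leaf [x] would be adjacent to [x]. As [x] has degree one, this leaves at most two
    vertices. A single edge shows that two leaves would not suffice. *)
Lemma exists_inner_vertex :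
  symmetric e -> connected_graph e -> (2 < #|leaves e|)%N ->
  exists x, x \notin leaves e.
Proof.
move=> esym [_ econ] k2.
have [/existsP//|/existsPn allL] := boolP [exists x, x \notin leaves e].
have /card_gt0P[x xL] : (0 < #|leaves e|)%N by apply: leq_trans k2.
have /subset_leq_card : ~: [set x] \subset [set y | e x y].
  apply/subsetP => z; rewrite !inE => zx.
  have [[|y [|w p]] [/= ep up pz]] := uniq_path_of_connect (econ x z).
  - by rewrite pz eqxx in zx.
  - by rewrite -pz; case/andP: ep.
  - case/and3P: ep => exy eyw _; case/andP: up; rewrite !inE !negb_or.
    case/and3P => _ xw _ _; have := allL y.
    by rewrite (inner_notin_leaves _ eyw xw) // esym.
rewrite cardsC1; have := xL; rewrite inE => /eqP ->.
have := leq_trans k2 (max_card (mem (leaves e))).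
by case: #|V| => [|[|[]]].
Qed.

Lemma connect_induced_subgraph (A : {set V}) (x : V) (p : seq V) :
  symmetric e -> ~: leaves e \subset A ->
  path e x p -> uniq (x :: p) -> x \in A -> last x p \in A ->
  connect (edge (induced_subgraph A)) x (last x p).
Proof.
move=> esym LA; elim: p x => [|y p IHp] x /=; first by rewrite connect0.
move=> /andP[exy ep] /andP[xp up] xA lA.
(* Either [y] is the end of the path, or it has the distinct neighbours [x] and [z] and so is not a
   leaf. *)
have yA : y \in A.
  case: p ep xp lA {IHp up} => [//|z p] /= /andP[eyz _].
  rewrite !inE !negb_or => /and3P[_ xz _] _.
  apply: (subsetP LA); rewrite inE.
  by apply: (inner_notin_leaves _ eyz xz); rewrite esym.
apply: connect_trans (IHp y ep up yA lA).
by apply: connect1; rewrite /edge inE /= xA yA.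
Qed.

(** The inner vertex [v] keeps this subgraph nonempty even when [S] is empty. *)
Lemma is_subtree_leaf_deleted (S : {set V}) :
  symmetric e -> connected_graph e -> (2 < #|leaves e|)%N ->
  is_subtree e (induced_subgraph (~: leaves e :|: S)).
Proof.
move=> esym eC k2; have [v vL] := exists_inner_vertex esym eC k2.
case: eC => _ econ.
split; first exact: induced_subgraph_is_subgraph.
split; first by apply/set0Pn; exists v; rewrite in_setU in_setC vL.
move=> x y xA yA; have [p [ep up py]] := uniq_path_of_connect (econ x y).
by rewrite -py in yA *; apply: connect_induced_subgraph => //; exact: subsetUl.
Qed.

Lemma intersects_vertex (x : V) (S : {set V}) : x \in leaves e ->
  intersects (induced_subgraph [set x])
    (induced_subgraph (~: leaves e :|: S)) = (x \in S).
Proof.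
move=> xL; rewrite /intersects setI_eq0 disjoints1 negbK.
by rewrite in_setU in_setC xL.
Qed.

Lemma homogeneous_pair_size (H1 H2 : {mset subgraph V}%mset) :
  (H1 `<=` seq_mset
     [seq induced_subgraph [set x] | x <- enum (leaves e)])%mset ->
  (H2 `<=` seq_mset [seq induced_subgraph (~: leaves e :|: A)
                      | A <- enum (powerset (leaves e))])%mset ->
  all_intersect H1 H2 \/ all_disjoint H1 H2 ->
  (size H2 * 2 ^ size H1 <= 2 ^ #|leaves e|)%N.
Proof.
move=> /size_msubset_image H1F /size_msubset_image H2F H12.
(* Both sizes are bounded by those of their index sets: the leaves occurring in [H1] and the leaf
   sets [A] occurring in [H2]. *)
have := H1F; rewrite -(@leq_exp2l 2) // => /(leq_mul H2F)/leq_trans; apply.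
apply: card_subsets_of_family.
- by apply/subsetP => x; rewrite inE => /andP[].
- by move=> S; rewrite inE powersetE => /andP[].
- case: H12 => H12; [left|right] => S; rewrite inE => /andP[_ SH2].
    apply/subsetP => x; rewrite inE => /andP[xL xH1].
    by rewrite -intersects_vertex ?H12.
  rewrite disjoint_subset; apply/subsetP => x; rewrite !inE => /andP[xL xH1].
  by rewrite -intersects_vertex ?H12 // inE.
Qed.

End Trees.

(** * The real estimate and the conclusion *)

Local Open Scope ring_scope.

(** The first bound reads [h <= 2 * log2 k]. If it fails, then [2 ^ h >= k], whence
    [n <= 2 ^ k / k], and [1 / k] is at most the ratio because [ln 2 <= ln k]. *)
Lemma ln_ratio_bound (R : realType) (k h n : nat) :
  (1 < k)%N -> (n * 2 ^ h <= 2 ^ k)%N ->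
  h%:R <= 2 * ln (k%:R : R) / (k%:R * ln 2) * k%:R \/
  n%:R <= 2 * ln (k%:R : R) / (k%:R * ln 2) * (2 ^ k)%:R.
Proof.
move=> k1 nh.
have k0 : 0 < k%:R :> R by rewrite ltr0n ltnW.
have ln2 : 0 < ln 2 :> R by rewrite ln_gt0 // ltr1n.
have lnk : ln 2 <= ln (k%:R : R) by rewrite ler_ln ?posrE ?ler_nat.
have lnk0 : 0 < ln (k%:R : R) by exact: lt_le_trans lnk.
have -> : 2 * ln (k%:R : R) / (k%:R * ln 2) * k%:R = 2 * ln k%:R / ln 2.
  by rewrite invfM mulrA mulrAC divfK // lt0r_neq0.
have [|hk] := leP (h%:R : R) (2 * ln k%:R / ln 2); [by left|right].
(* Only [h >= log2 k] is kept from [hk]; the factor 2 is slack. *)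
have kh : (k <= 2 ^ h)%N.
  rewrite -(ler_nat R) -ler_ln ?posrE ?ltr0n ?expn_gt0 ?(ltnW k1) // natrX lnXn //.
  rewrite -[ln _ *+ h]mulr_natl.
  move: hk; rewrite ltr_pdivrMr // => /ltW; apply: le_trans.
  by rewrite ler_peMl ?ler1n // ltW.
apply: (@le_trans _ _ ((2 ^ k)%:R / k%:R)).
  rewrite ler_pdivlMr // -natrM ler_nat; apply: leq_trans nh.
  by rewrite leq_mul2l kh orbT.
rewrite mulrC ler_wpM2r ?ler0n // invfM mulrCA ler_peMr ?invr_ge0 ?(ltW k0) //.
rewrite ler_pdivlMr // mul1r; apply: (le_trans lnk).
by rewrite ler_peMl ?ler1n // ltW.
Qed.

(** Nonemptiness is part of the conclusion, since an empty family would satisfy its bound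
    trivially. *)
Theorem theorem5p1 (R : realType) (k : nat) (hk : (17 <= k)%N)
    (V : finType) (e : rel V) (T_tree : is_tree e)
    (T_leaves : #|leaves e| = k) :
  exists F1 F2 : {mset subgraph V}%mset,
    [/\ F1 != mset0, F2 != mset0, subtree_family e F1, subtree_family e F2 &
      forall H1 H2 : {mset subgraph V}%mset,
        (H1 `<=` F1)%mset -> (H2 `<=` F2)%mset ->
        all_intersect H1 H2 \/ all_disjoint H1 H2 ->
        (size H1)%:R <= 2 * ln (k%:R : R) / (k%:R * ln 2) * (size F1)%:R \/
        (size H2)%:R <= 2 * ln (k%:R : R) / (k%:R * ln 2) * (size F2)%:R].
Proof.
pose s1 := [seq induced_subgraph e [set x] | x <- enum (leaves e)].
pose s2 := [seq induced_subgraph e (~: leaves e :|: A)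
             | A <- enum (powerset (leaves e))].
have sz1 : size (seq_mset s1) = k.
  by rewrite (perm_size (perm_eq_seq_mset s1)) size_map -cardE.
have sz2 : size (seq_mset s2) = (2 ^ k)%N.
  rewrite (perm_size (perm_eq_seq_mset s2)) size_map -cardE.
  by rewrite card_powerset T_leaves.
exists (seq_mset s1), (seq_mset s2); split.
- by rewrite -size_mset_eq0 sz1 -lt0n; apply: leq_trans hk.
- by rewrite -size_mset_eq0 sz2 expn_eq0.
- move=> s; rewrite (perm_mem (perm_eq_seq_mset s1)) => /mapP[x _ ->].
  by apply: is_subtree_vertex; case: T_tree => -[].
- move=> s; rewrite (perm_mem (perm_eq_seq_mset s2)) => /mapP[A _ ->].
  case: T_tree => -[esym _] econ _; apply: is_subtree_leaf_deleted => //.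
  by rewrite T_leaves; apply: leq_trans hk.
- move=> H1 H2 H1F H2F H12; rewrite sz1 sz2.
  apply: ln_ratio_bound; first exact: leq_trans hk.
  by rewrite -T_leaves; exact: homogeneous_pair_size H1F H2F H12.
Qed.
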